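(* Let $\mathcal A=(Q,\{a,b\},\delta)$ be an automaton in which $b$ acts as a permutation of $Q$ and $a$ is of type $[1,2,3]\backslash 1,2$, where $1,2,3$ are distinct states of $Q$. Then $\mathcal A$ is $3$-compressible and proper if and only if both of the following conditions hold: (1) $Orb_b(1,2)\not\subseteq\{1,2,3\}$; (2) $\{1,2\}b\subset\{1,2,3\}$. Moreover, if $\mathcal A$ is proper and $3$-compressible, then the word $ab^2a$ $3$-compresses $\mathcal A$.
   Context: A (semi)automaton is $\mathcal A=(Q,\Sigma,\delta)$ with $Q$ a finite set of states, $\Sigma=\{a,b\}$, and $\delta:Q\times\Sigma\to Q$ total. Words act on states from the right, letter by letter from left to right: $qw$ is the state reached from $q$ by reading $w$; for $S\subseteq Q$, $Sw=\{qw:q\in S\}$. A word $w$ $3$-compresses $\mathcal A$ if $|Q|-|Qw|\ge 3$; $\mathcal A$ is $3$-compressible if some word $3$-compresses it. A $3$-compressible automaton is proper if no word of length $3$ $3$-compresses it. The letter $a$ is of type $[1,2,3]\backslash 1,2$ if $1a=2a=3a$, no other two distinct states have the same image under $a$, and $Q\setminus Qa=\{1,2\}$. For $S\subseteq Q$, $Orb_b(S)=\{qb^n: q\in S,\ n\ge 0\}$, and $Orb_b(1,2)=Orb_b(\{1,2\})$. *)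

(* Defs.v *)
From mathcomp Require Import all_boot.

Set Implicit Arguments.
Unset Strict Implicit.
Unset Printing Implicit Defensive.

Inductive letter := La | Lb.

Definition word := seq letter.

Section Semiautomaton.

(* The semiautomaton (Q, {a, b}, delta). *)
Variables (Q : finType) (delta : Q -> letter -> Q).

(* q w : words act from the right and are read from left to right. *)
Definition run (q : Q) (w : word) : Q := foldl delta q w.

(* S w *)
Definition run_set (S : {set Q}) (w : word) : {set Q} :=
  [set run q w | q in S].

Definition compresses (k : nat) (w : word) : bool :=
  k <= #|Q| - #|run_set [set: Q] w|.

Definition compressible (k : nat) : Prop := exists w : word, compresses k w.

(* Properness is a property of 3-compressible automata; 3-compressibility is
   not part of this definition and has to be stated separately. *)
Definition proper3 : Prop :=
  forall w : word, size w = 3 -> ~~ compresses 3 w.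

Definition letter_perm (c : letter) : Prop := bijective (delta^~ c).

(* The letter c is of type [p, q, r] \ p, q. *)
Definition type_pqr_pq (c : letter) (p q r : Q) : Prop :=
  [/\ delta p c = delta q c,
      delta q c = delta r c,
      forall s t : Q, s != t -> delta s c = delta t c ->
        s \in [set p; q; r] /\ t \in [set p; q; r]
    & [set: Q] :\: run_set [set: Q] [:: c] = [set p; q]].

Definition Orb (c : letter) (S : {set Q}) : {set Q} :=
  \bigcup_(q in S) [set p in orbit (delta^~ c) q].

Lemma OrbP (c : letter) (S : {set Q}) (p : Q) :
  reflect (exists2 q, q \in S & exists n, p = run q (nseq n c))
          (p \in Orb c S).
Proof.
have runE q n : run q (nseq n c) = iter n (delta^~ c) q.
  by elim: n q => //= n IHn q; rewrite -[RHS]/(iter n.+1 (delta^~ c) q) iterSr -IHn.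
apply: (iffP bigcupP) => -[q qS].
  rewrite inE -fconnect_orbit => /iter_findex <-.
  by exists q => //; exists (findex (delta^~ c) q p); rewrite runE.
move=> [n ->]; exists q => //.
by rewrite inE -fconnect_orbit runE fconnect_iter.
Qed.

End Semiautomaton.

(* Main.v *)
Require Import Defs.
From mathcomp Require Import all_boot.

(** Everything follows from tracking the set of states missing from [Q w].
    Write P = {q1, q2} and T = {q1, q2, q3}. The letter a collapses T to one
    state and misses exactly P; the letter b permutes the missing states. So
    after reading a b^n the missing set is P b^n, of size 2, and there are two
    cases for the next a.
    - If P b^n is inside T, then the current image still contains everything
      outside T and at least one state of T, so a produces the full image Q a
      again: the process restarts with missing set P and nothing is gained.
    - Otherwise at most one state of T is missing, so two states of T are
      merged and a third state is lost.
    Hence a word that 3-compresses must be long enough to read a b^n a for some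
    n with P b^n not inside T ([compresses_escape]), and conversely every such
    a b^n a does 3-compress ([escape_compresses]). Compressibility thus means
    that some P b^n leaves T, that is, that the b-orbit of P leaves T, and
    properness means that P b^n is inside T for n = 1, the only nontrivial
    exponent allowed by three letters.

    Finally, T has just one state more than P, so if P b is inside T then
    either P is b-stable or P and P b together fill T. If moreover P b^2 is
    inside T, one of P, T is b-stable and the orbit never leaves T
    ([two_steps_confine_orbit]). So under both conditions P b^2 leaves T, which
    makes a b^2 a compressing.

    All the counting rests on the relation |T| = |P| + 1, so the lemmas are
    stated for sets P and T of any size. *)

Set Implicit Arguments.
Unset Strict Implicit.
Unset Printing Implicit Defensive.

Section Images.

Variables (Q : finType) (delta : Q -> letter -> Q).
Implicit Types (S T P U : {set Q}) (c : letter) (w : word).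

Lemma run_set0 S : run_set delta S [::] = S.
Proof. by rewrite /run_set imset_id. Qed.

Lemma run_set_cat S u v :
  run_set delta S (u ++ v) = run_set delta (run_set delta S u) v.
Proof.
by rewrite /run_set -imset_comp; apply: eq_imset => q; rewrite /run foldl_cat.
Qed.

Lemma run_setS S T w : S \subset T -> run_set delta S w \subset run_set delta T w.
Proof. exact: imsetS. Qed.

Lemma run_set_nseqS S n c :
  run_set delta S (nseq n.+1 c) = run_set delta (run_set delta S (nseq n c)) [:: c].
Proof. by rewrite -addn1 nseqD run_set_cat. Qed.

Lemma run_perm_inj c n :
  letter_perm delta c -> injective (run delta ^~ (nseq n c)).
Proof.
move=> /bij_inj c_inj; elim: n => [|n IHn] q r //= eq_run.
exact/c_inj/IHn.
Qed.

Lemma card_run_set_perm c n S :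
  letter_perm delta c -> #|run_set delta S (nseq n c)| = #|S|.
Proof. by move=> c_perm; apply/card_imset/run_perm_inj. Qed.

Lemma run_setC_perm c n S :
  letter_perm delta c ->
  run_set delta (~: S) (nseq n c) = ~: run_set delta S (nseq n c).
Proof.
move=> c_perm; have c_inj := run_perm_inj (n := n) c_perm.
apply/eqP; rewrite eqEcard; apply/andP; split.
  apply/subsetP => _ /imsetP[q qNS ->]; rewrite inE.
  by rewrite (mem_imset _ _ c_inj) -in_setC.
by rewrite (cardsCs (~: run_set _ _ _)) setCK !card_run_set_perm //
  (cardsCs (~: S)) setCK.
Qed.

Lemma Orb_subsetP c S T :
  (forall n, run_set delta S (nseq n c) \subset T) <-> Orb delta c S \subset T.
Proof.
split=> [ST | /subsetP ST n].
  apply/subsetP => _ /OrbP[q qS [n ->]].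
  by apply: (subsetP (ST n)); apply: imset_f.
by apply/subsetP => _ /imsetP[q qS ->]; apply/ST/OrbP; exists q => //; exists n.
Qed.

Lemma Orb_subset_stable c P U :
  P \subset U -> run_set delta U [:: c] \subset U -> Orb delta c P \subset U.
Proof.
move=> PU Uc; apply/Orb_subsetP; elim=> [|n IHn]; first by rewrite run_set0.
by rewrite run_set_nseqS; apply: subset_trans (run_setS _ IHn) Uc.
Qed.

(** There is room for only one state between [P] and [T]: either [P] is already
    stable, or its first step outside [P] completes it to [T], and then the
    second step shows that [T] is stable. *)
Lemma two_steps_confine_orbit c P T :
    #|T| = #|P|.+1 -> P \subset T ->
    run_set delta P [:: c] \subset T -> run_set delta P [:: c; c] \subset T ->
  Orb delta c P \subset T.
Proof.
move=> cardT PT PcT PccT.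
have [PcP | PcNP] := boolP (run_set delta P [:: c] \subset P).
  exact: subset_trans (Orb_subset_stable (subxx P) PcP) PT.
have defT : P :|: run_set delta P [:: c] = T.
  apply/eqP; rewrite eqEcard subUset PT PcT cardT /=.
  by apply: proper_card; rewrite properUl.
apply: Orb_subset_stable => //.
rewrite -{1}defT /run_set imsetU subUset -/(run_set delta P [:: c]) PcT /=.
by rewrite -/(run_set delta _ [:: c]) -run_set_cat.
Qed.

End Images.

Section MergingLetter.

(** Merging [T] alone already loses [#|T|.-1] states, so [cardT] makes it
    account for the whole defect [P] of [a]. *)
Variables (Q : finType) (delta : Q -> letter -> Q) (a b : letter).
Variables (P T : {set Q}).
Implicit Types (S : {set Q}) (w : word).
Hypothesis b_perm : letter_perm delta b.
Hypothesis letterP : forall c, c = a \/ c = b.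
Hypothesis T_merged : {in T &, forall s t, delta s a = delta t a}.
Hypothesis a_image : run_set delta [set: Q] [:: a] = ~: P.
Hypothesis cardT : #|T| = #|P|.+1.

Let missing n := run_set delta P (nseq n b).

Let card_missing n : #|missing n| = #|P|.
Proof. exact: card_run_set_perm. Qed.

(** A set that contains all of [~: T] misses nothing that [a] could
    distinguish, as soon as it contains one state of [T]; counting provides
    that state. *)
Lemma merge_restart n S :
    missing n \subset T -> ~: missing n \subset S ->
  ~: P \subset run_set delta S [:: a].
Proof.
move=> missT /subsetP missS.
have /subsetPn[t tT tNmiss] : ~~ (T \subset missing n).
  by apply: contraL (leqnn #|T|) => /subset_leq_card; rewrite cardT card_missing ltnn.
rewrite -a_image; apply/subsetP => _ /imsetP[q _ ->].
have [qT | qNT] := boolP (q \in T).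
  have -> : run delta q [:: a] = run delta t [:: a] by apply: T_merged.
  by apply/imset_f/missS; rewrite inE.
by apply/imset_f/missS; rewrite inE; apply: contra qNT; apply: (subsetP missT).
Qed.

(** Nothing is missing before the first [a]; afterwards each [b] moves the
    missing set and each [a] resets it. The bound on [n] in the hypothesis
    reflects that [missing n] is only reached after
    [n.+1] letters, and tested against [T] by a further [a]. *)
Lemma image_lower_bound w :
    (forall n, n.+1 < size w -> missing n \subset T) ->
  run_set delta [set: Q] w = [set: Q] \/
  exists2 n, n < size w & ~: missing n \subset run_set delta [set: Q] w.
Proof.
elim/last_ind: w => [|w c IHw] missT; first by left; rewrite run_set0.
rewrite size_rcons in missT *; rewrite -cats1 run_set_cat.
case: IHw => [n n_w | -> | [n n_w missw]]; first exact/missT/ltnW.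
- case: (letterP c) => ->.
    by right; exists 0; rewrite // a_image /missing run_set0.
  left; rewrite -setC0 -[[:: b]]/(nseq 1 b) run_setC_perm //.
  by rewrite /run_set imset0.
- right; case: (letterP c) => ->.
    by exists 0; rewrite // /missing run_set0; apply: merge_restart missw; apply: missT.
  exists n.+1; rewrite // /missing run_set_nseqS -[[:: b]]/(nseq 1 b).
  by rewrite -run_setC_perm // run_setS.
Qed.

Lemma compresses_escape w :
    compresses delta #|P|.+1 w ->
  exists2 n, n.+1 < size w & ~~ (missing n \subset T).
Proof.
move=> w_compr.
have [/existsP[n nT] | /existsPn missT] :=
    boolP [exists n : 'I_(size w).-1, ~~ (missing n \subset T)].
  by exists n; rewrite // -ltn_predRL.
case: (@image_lower_bound w) => [n n_w | Qw | [n _ missw]].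
- by rewrite -ltn_predRL in n_w; have := missT (Ordinal n_w); rewrite negbK.
- by move: w_compr; rewrite /compresses Qw cardsT subnn.
- (* only |P| states can be missing, one less than required *)
  move: w_compr; rewrite /compresses leqNgt ltnS leq_subLR addnC.
  by rewrite -(cardsC (missing n)) card_missing leq_add2l subset_leq_card.
Qed.

(** If [missing n] has a state outside [T], it cannot remove more than
    [#|P|.-1] states of [T], so two states of [T] survive and get merged. *)
Lemma escape_compresses n :
  ~~ (missing n \subset T) -> compresses delta #|P|.+1 (a :: rcons (nseq n b) a).
Proof.
move=> missNT; rewrite /compresses -cat1s -cats1 !run_set_cat a_image.
rewrite run_setC_perm // -/(missing n).
have /card_gt1P[s [t [sTm tTm s_neq_t]]] : 1 < #|T :\: missing n|.
  rewrite cardsD cardT ltn_subRL addn1 ltnS -(card_missing n) setIC.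
  by apply: proper_card; rewrite properIl.
have [[sm sT] [tm tT]] := (setDP sTm, setDP tTm).
have ltS : #|run_set delta (~: missing n) [:: a]| < #|~: missing n|.
  rewrite ltn_neqAle leq_imset_card andbT; apply: contra s_neq_t => /imset_injP a_inj.
  by apply/eqP/a_inj; rewrite ?inE //; apply: T_merged.
rewrite -{1}(card_missing n) -(cardsC (missing n)) -addnBA; last exact: ltnW.
by rewrite -addn1 leq_add2l subn_gt0.
Qed.

End MergingLetter.

Theorem proposition8 (Q : finType) (delta : Q -> letter -> Q) (q1 q2 q3 : Q)
    (distinct : uniq [:: q1; q2; q3])
    (b_perm : letter_perm delta Lb)
    (a_type : type_pqr_pq delta La q1 q2 q3) :
  ((compressible delta 3 /\ proper3 delta) <->
     (~~ (Orb delta Lb [set q1; q2] \subset [set q1; q2; q3]) /\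
      run_set delta [set q1; q2] [:: Lb] \subset [set q1; q2; q3]))
  /\
  (proper3 delta /\ compressible delta 3 ->
     compresses delta 3 [:: La; Lb; Lb; La]).
Proof.
set P := [set q1; q2]; set T := [set q1; q2; q3].
have [eq12 eq23 _ missP] := a_type.
have cardP : #|P| = 2.
  by move: distinct; rewrite cards2 /= inE negb_or => /andP[/andP[-> _] _].
have cardT : #|T| = #|P|.+1.
  rewrite /T setUC cardsU1 -/P cardP; move: distinct.
  by rewrite /= !inE !negb_or andbT -andbA ![_ == q3]eq_sym => /and3P[_ -> ->].
have PT : P \subset T by apply: subsetUl.
have letterP c : c = La \/ c = Lb by case: c; [left | right].
have T_merged : {in T &, forall s t, delta s La = delta t La}.
  have toq1 s : s \in T -> delta s La = delta q1 La.
    by rewrite !inE -orbA => /or3P[] /eqP-> //; rewrite eq12 // eq23.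
  by move=> s t /toq1-> /toq1->.
have a_image : run_set delta [set: Q] [:: La] = ~: P.
  by rewrite /P -missP setTD setCK.
have escape w : compresses delta 3 w ->
    exists2 n, n.+1 < size w & ~~ (run_set delta P (nseq n Lb) \subset T).
  by rewrite -cardP; apply: compresses_escape.
have compr n : ~~ (run_set delta P (nseq n Lb) \subset T) ->
    compresses delta 3 (La :: rcons (nseq n Lb) La).
  by rewrite -cardP; apply: escape_compresses.
have compressibleE : compressible delta 3 <-> ~~ (Orb delta Lb P \subset T).
  split=> [[w /escape[n _]] | OrbNT].
    by apply: contra => /Orb_subsetP.
  have /subsetPn[_ /OrbP[q qP [n ->]] qNT] := OrbNT.
  exists (La :: rcons (nseq n Lb) La); apply: compr.
  by apply/subsetPn; exists (run delta q (nseq n Lb)); first exact: imset_f.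
have properE : proper3 delta <-> run_set delta P [:: Lb] \subset T.
  split=> [no3 | PbT w size_w].
    by apply: contraT => /(compr 1); apply: contraLR => _; apply: no3.
  apply/negP => /escape[[|[|n]]]; rewrite size_w //= ?PbT //.
  by rewrite run_set0 PT.
split; first by split=> -[/compressibleE ? /properE ?].
move=> [/properE PbT /compressibleE OrbNT]; apply: (compr 2).
by apply: contra OrbNT; apply: two_steps_confine_orbit.
Qed.
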